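(* Suppose a logic $\mathcal L$ is an extension of first-order logic and has the low rank definability property on a class $\mathcal C$ of (vertex-colored) graphs. Then for every formula of low rank MSO there is a formula of $\mathcal L$ such that the two formulas are equivalent on all graphs from $\mathcal C$.
   Context: Graphs are finite, simple, undirected, vertex-colored. A logic here is a collection of formulas over graphs, possibly with free vertex variables and free set variables, with the usual semantics, closed under the first-order constructors (Boolean combinations, vertex quantification, atoms $E(x,y)$, $x=y$, unary predicates, $x\in X$); $\mathcal L$ is an extension of first-order logic if it contains first-order logic as a fragment. For $X\subseteq V(G)$, $\mathrm{rk}(X)$ is the rank over $\mathbb F_2$ of the bipartite adjacency matrix between $X$ and $V(G)\setminus X$. Low rank MSO is MSO over graphs in which every set quantifier is $\exists X\colon r$/$\forall X\colon r$, ranging over sets of rank at most $r$. For a formula $\psi(x,\bar t,\bar Y,\bar z)$ with evaluations $\bar d,\bar B,\bar c$, write $\psi(G,\bar d,\bar B,\bar c)=\{v\in V(G): G\models\psi(v,\bar d,\bar B,\bar c)\}$. $\mathcal L$ has the low rank definability property on $\mathcal C$ if for every $r\in\mathbb N$ and every formula $\varphi(X,\bar Y,\bar z)$ of $\mathcal L$ (free set variables $X,\bar Y$, free vertex variables $\bar z$) there is a formula $\psi(x,\bar t,\bar Y,\bar z)$ of $\mathcal L$ such that for every $G\in\mathcal C$ and evaluations $\bar B$ of $\bar Y$ and $\bar c$ of $\bar z$: if there is $A\subseteq V(G)$ with $\mathrm{rk}(A)\le r$ and $G\models\varphi(A,\bar B,\bar c)$, then there are $A'\subseteq V(G)$ and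 a tuple $\bar d$ of vertices evaluating $\bar t$ with $G\models\varphi(A',\bar B,\bar c)$ and $A'=\psi(G,\bar d,\bar B,\bar c)$. *)

(* Defs.v *)
From mathcomp Require Import all_boot all_algebra.

Set Implicit Arguments.
Unset Strict Implicit.
Unset Printing Implicit Defensive.

Import GRing.Theory.

(* [Sigma] is the set of colors; each color is interpreted as an arbitrary
   unary predicate on the vertices. *)
Record cgraph (Sigma : Type) := CGraph {
  vertex :> finType;
  adj : rel vertex;
  adj_sym : symmetric adj;
  adj_irr : irreflexive adj;
  color : Sigma -> pred vertex }.

Definition cut_matrix (Sigma : Type) (G : cgraph Sigma) (X : {set G}) :
    'M['F_2]_(#|X|, #|~: X|) :=
  (\matrix_(i, j) (adj (enum_val i) (enum_val j))%:R)%R.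

Definition rk (Sigma : Type) (G : cgraph Sigma) (X : {set G}) : nat :=
  \rank (cut_matrix X).

(* [lrmso Sigma m k]: formulas with free vertex variables x_0, ..., x_(m-1) and
   free set variables X_0, ..., X_(k-1), as de Bruijn indices: a quantifier
   binds variable 0 of its sort and shifts the other variables of that sort. *)
Inductive lrmso (Sigma : Type) : nat -> nat -> Type :=
| LAdj m k (x y : 'I_m) : lrmso Sigma m k
| LEq m k (x y : 'I_m) : lrmso Sigma m k
| LColor m k (c : Sigma) (x : 'I_m) : lrmso Sigma m k
| LMem m k (x : 'I_m) (X : 'I_k) : lrmso Sigma m k
| LNot m k (f : lrmso Sigma m k) : lrmso Sigma m k
| LAnd m k (f g : lrmso Sigma m k) : lrmso Sigma m k
| LOr m k (f g : lrmso Sigma m k) : lrmso Sigma m k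
| LExV m k (f : lrmso Sigma m.+1 k) : lrmso Sigma m k
| LAllV m k (f : lrmso Sigma m.+1 k) : lrmso Sigma m k
| LExS m k (r : nat) (f : lrmso Sigma m k.+1) : lrmso Sigma m k
| LAllS m k (r : nat) (f : lrmso Sigma m k.+1) : lrmso Sigma m k.

Fixpoint lrsat (Sigma : Type) m k (f : lrmso Sigma m k) (G : cgraph Sigma) :
    m.-tuple G -> k.-tuple {set G} -> Prop :=
  match f in lrmso _ m k return m.-tuple G -> k.-tuple {set G} -> Prop with
  | LAdj _ _ x y => fun v _ => adj (tnth v x) (tnth v y)
  | LEq _ _ x y => fun v _ => tnth v x = tnth v y
  | LColor _ _ c x => fun v _ => color c (tnth v x)
  | LMem _ _ x X => fun v B => tnth v x \in tnth B X
  | LNot _ _ f => fun v B => ~ lrsat f v B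
  | LAnd _ _ f g => fun v B => lrsat f v B /\ lrsat g v B
  | LOr _ _ f g => fun v B => lrsat f v B \/ lrsat g v B
  | LExV _ _ f => fun v B => exists x : G, lrsat f [tuple of x :: v] B
  | LAllV _ _ f => fun v B => forall x : G, lrsat f [tuple of x :: v] B
  | LExS _ _ r f => fun v B =>
      exists X : {set G}, rk X <= r /\ lrsat f v [tuple of X :: B]
  | LAllS _ _ r f => fun v B =>
      forall X : {set G}, rk X <= r -> lrsat f v [tuple of X :: B]
  end.

(* First-order formulas may have free set variables (in atoms x \in X), but
   quantify over vertices only. *)
Fixpoint first_order (Sigma : Type) m k (f : lrmso Sigma m k) : bool :=
  match f with
  | LAdj _ _ _ _ | LEq _ _ _ _ | LColor _ _ _ _ | LMem _ _ _ _ => true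
  | LNot _ _ f => first_order f
  | LAnd _ _ f g | LOr _ _ f g => first_order f && first_order g
  | LExV _ _ f | LAllV _ _ f => first_order f
  | LExS _ _ _ _ | LAllS _ _ _ _ => false
  end.

(* [form m k] are the formulas whose free variables are among m vertex
   variables and k set variables.  [logic_rename] says that a formula stays a
   formula when its free variables are renamed apart and dummy variables are
   added; it does not allow identifying variables.  The connectives and
   quantifier that are not listed are obtained by (classical) duality.  No
   closure under substituting formulas for set variables is assumed. *)
Record logic (Sigma : Type) := Logic {
  form : nat -> nat -> Type;
  sat : forall m k, form m k ->
    forall G : cgraph Sigma, m.-tuple G -> k.-tuple {set G} -> Prop;
  logic_adj : forall m k (x y : 'I_m), exists h : form m k,
    forall (G : cgraph Sigma) (v : m.-tuple G) (B : k.-tuple {set G}),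
      sat h v B <-> adj (tnth v x) (tnth v y);
  logic_eq : forall m k (x y : 'I_m), exists h : form m k,
    forall (G : cgraph Sigma) (v : m.-tuple G) (B : k.-tuple {set G}),
      sat h v B <-> tnth v x = tnth v y;
  logic_color : forall m k (c : Sigma) (x : 'I_m), exists h : form m k,
    forall (G : cgraph Sigma) (v : m.-tuple G) (B : k.-tuple {set G}),
      sat h v B <-> color c (tnth v x);
  logic_mem : forall m k (x : 'I_m) (X : 'I_k), exists h : form m k,
    forall (G : cgraph Sigma) (v : m.-tuple G) (B : k.-tuple {set G}),
      sat h v B <-> tnth v x \in tnth B X;
  logic_not : forall m k (f : form m k), exists h : form m k,
    forall (G : cgraph Sigma) (v : m.-tuple G) (B : k.-tuple {set G}),
      sat h v B <-> ~ sat f v B;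
  logic_and : forall m k (f g : form m k), exists h : form m k,
    forall (G : cgraph Sigma) (v : m.-tuple G) (B : k.-tuple {set G}),
      sat h v B <-> sat f v B /\ sat g v B;
  logic_exv : forall m k (f : form m.+1 k), exists h : form m k,
    forall (G : cgraph Sigma) (v : m.-tuple G) (B : k.-tuple {set G}),
      sat h v B <-> exists x : G, sat f [tuple of x :: v] B;
  logic_rename : forall m k m' k' (s : 'I_m -> 'I_m') (t : 'I_k -> 'I_k'),
    injective s -> injective t -> forall f : form m k, exists h : form m' k',
    forall (G : cgraph Sigma) (v : m'.-tuple G) (B : k'.-tuple {set G}),
      sat h v B <-> sat f [tuple tnth v (s i) | i < m]
                          [tuple tnth B (t i) | i < k] }.

Arguments form {Sigma} l m k.
Arguments sat {Sigma l m k} f {G} v B.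
Arguments lrsat {Sigma m k} f {G} v B.

Definition extends_FO (Sigma : Type) (L : logic Sigma) : Prop :=
  forall m k (f : lrmso Sigma m k), first_order f ->
  exists h : form L m k,
    forall (G : cgraph Sigma) (v : m.-tuple G) (B : k.-tuple {set G}),
      lrsat f v B <-> sat h v B.

(* In phi, set variable 0 plays the role of X; in psi, vertex variable 0 plays
   the role of x, and is followed by the t-tuple d and then by c. *)
Definition low_rank_definability (Sigma : Type) (L : logic Sigma)
    (C : cgraph Sigma -> Prop) : Prop :=
  forall (r m k : nat) (phi : form L m k.+1),
  exists (t : nat) (psi : form L (t + m).+1 k),
  forall G : cgraph Sigma, C G ->
  forall (B : k.-tuple {set G}) (c : m.-tuple G),
  (exists A : {set G}, rk A <= r /\ sat phi c [tuple of A :: B]) ->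
  exists (A' : {set G}) (d : t.-tuple G),
    sat phi c [tuple of A' :: B] /\
    (forall x : G, x \in A' <-> sat psi [tuple of x :: d ++ c] B).

(* Main.v *)
(** Call a property of graphs with parameters substitutable if it is definable
    in L on C whenever its set parameters are replaced by sets definable in L.
    By induction every low rank MSO formula is substitutable.  For a quantifier
    [exists X : r], low rank definability applied to "rk X <= r and f(X)"
    provides a definition psi(x, d) of a witness, so that the quantifier becomes
    [exists d] over vertices, with X replaced by psi(., d).  The bound
    rk X <= r has to be kept, as the witness A' need not be the set A; it is
    first-order: r + 1 vertices of X have linearly independent rows iff every
    nonzero combination of these rows is nonzero at some vertex outside X. *)
From mathcomp Require Import all_boot all_algebra.
From Stdlib Require Import Classical ClassicalEpsilon.
Require Import Defs.

Set Implicit Arguments.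
Unset Strict Implicit.
Unset Printing Implicit Defensive.

Import GRing.Theory.

(** * Linear independence of rows of the cut matrix *)

(** From left to right, take the first r + 1 rows of a maximal independent family of rows.
    Conversely, the vertices [y] select a row-free submatrix, whose rank r + 1 bounds that of the
    cut matrix from below. *)
Lemma rk_gtP (Sigma : Type) (G : cgraph Sigma) (S : {set G}) (r : nat) :
  r < rk S <->
  exists y : r.+1.-tuple G, (forall i, tnth y i \in S) /\
    forall c : 'rV['F_2]_r.+1, c != 0%R ->
    exists z, z \notin S /\
      (\sum_i c ord0 i * (adj (tnth y i) z)%:R != 0)%R.
Proof.
rewrite /rk; set A := cut_matrix S; split=> [lt_r | [y [yS indep]]].
  pose f i := maxrankfun A (widen_ord lt_r i).
  exists [tuple enum_val (f i) | i < r.+1]; split=> [i|c c0].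
    by rewrite tnth_mktuple enum_valP.
  have free_f : row_free (rowsub f A).
    (* Keeping the first r + 1 rows is multiplication by [pid_mx r.+1]; the right factor is
       row-free, so the product has the rank of [pid_mx r.+1]. *)
    have -> : rowsub f A = (pid_mx r.+1 *m rowsub (maxrankfun A) A)%R.
      apply/matrixP=> i j; rewrite !mxE (bigD1 (widen_ord lt_r i)) //=.
      rewrite big1 ?addr0 => [|k neq_k]; rewrite !mxE.
        by rewrite /= eqxx ltn_ord mul1r.
      by rewrite -val_eqE eq_sym in neq_k; rewrite (negbTE neq_k) mul0r.
    by rewrite /row_free mxrankMfree ?maxrowsub_free // rank_pid_mx.
  have nz : (c *m rowsub f A != 0)%R.
    by apply: contraNneq c0 => e; apply/eqP/(row_free_inj free_f); rewrite e mul0mx.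
  have [j nzj] : exists j, ((c *m rowsub f A) ord0 j != 0)%R.
    apply/existsP; apply: contraNT nz => /existsPn h.
    by apply/eqP/rowP=> j; rewrite [RHS]mxE; apply/eqP; have := h j; rewrite negbK.
  exists (enum_val j); split; first by have := enum_valP j; rewrite inE.
  move: nzj; rewrite mxE; under eq_bigr => i _ do rewrite !mxE.
  by under [in X in _ -> X]eq_bigr => i _ do rewrite tnth_mktuple.
pose g i := enum_rank_in (yS ord0) (tnth y i).
have free_g : row_free (rowsub g A).
  apply: inj_row_free => c cA; apply/eqP; apply: contraT => /indep [z [zS]].
  have zC : z \in ~: S by rewrite inE.
  move/rowP/(_ (enum_rank_in zC z)): cA; rewrite !mxE => e.
  case/eqP; rewrite -[RHS]e; apply: eq_bigr => i _.
  by rewrite !mxE !enum_rankK_in.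
rewrite -[r.+1](eqP free_g); apply/mxrankS/row_subP => i.
by rewrite row_rowsub row_sub.
Qed.

Definition suffix_tuple (T : Type) t n (w : (t + n).-tuple T) : n.-tuple T :=
  [tuple tnth w (rshift t i) | i < n].

Lemma suffix_tuple_cat (T : Type) t n (d : t.-tuple T) (v : n.-tuple T) :
  suffix_tuple [tuple of d ++ v] = v.
Proof. by apply: eq_from_tnth => i; rewrite tnth_mktuple tnth_rshift. Qed.

(** * Definability in [L] on [C] and its closure properties *)

Section Definability.
Variables (Sigma : Type) (L : logic Sigma) (C : cgraph Sigma -> Prop).

Definition vpred n l :=
  forall G : cgraph Sigma, n.-tuple G -> l.-tuple {set G} -> Prop.

Definition definable n l (P : vpred n l) : Prop :=
  exists h : form L n l, forall G, C G -> forall v B, P G v B <-> sat h v B.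

(** The index is chosen before the graph, so [x] denotes the same variable in all graphs. *)
Definition is_var n (x : forall G : cgraph Sigma, n.-tuple G -> G) : Prop :=
  exists j, forall G v, x G v = tnth v j.

Lemma is_var_tnth n (j : 'I_n) : is_var (fun G v => tnth v j).
Proof. by exists j. Qed.

Lemma is_var_suffix t n (x : forall G : cgraph Sigma, n.-tuple G -> G) :
  is_var x -> is_var (fun G (w : (t + n).-tuple G) => x G (suffix_tuple w)).
Proof.
move=> [j jP]; exists (rshift t j) => G w.
by rewrite jP tnth_mktuple.
Qed.

Lemma is_var_behead n (x : forall G : cgraph Sigma, n.-tuple G -> G) :
  is_var x -> is_var (fun G (v : n.+1.-tuple G) => x G [tuple of behead v]).
Proof.
move=> [j jP]; exists (lift ord0 j) => G v.
by rewrite jP [v in RHS]tuple_eta tnthS.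
Qed.

Lemma is_var_cons n m (x : forall G : cgraph Sigma, n.-tuple G -> G)
    (U : forall G : cgraph Sigma, n.-tuple G -> m.-tuple G) :
  is_var x -> (forall i, is_var (fun G v => tnth (U G v) i)) ->
  forall i, is_var (fun G v => tnth [tuple of x G v :: U G v] i).
Proof.
move=> varx varU i; case: (unliftP ord0 i) => [j|] ->; last exact: varx.
by have [k kP] := varU j; exists k => G v; rewrite tnthS.
Qed.

Lemma definable_ext n l (P Q : vpred n l) :
  (forall G, C G -> forall v B, P G v B <-> Q G v B) ->
  definable P -> definable Q.
Proof.
move=> PQ [h hP]; exists h => G CG v B.
by rewrite -hP // -PQ.
Qed.

Lemma definable_not n l (P : vpred n l) :
  definable P -> definable (fun G v B => ~ P G v B).
Proof.
move=> [f fP]; have [h hP] := logic_not f.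
by exists h => G CG v B; rewrite hP fP.
Qed.

Lemma definable_and n l (P Q : vpred n l) : definable P -> definable Q ->
  definable (fun G v B => P G v B /\ Q G v B).
Proof.
move=> [f fP] [g gP]; have [h hP] := logic_and f g.
by exists h => G CG v B; rewrite hP fP // gP.
Qed.

Lemma definable_or n l (P Q : vpred n l) : definable P -> definable Q ->
  definable (fun G v B => P G v B \/ Q G v B).
Proof.
move=> /definable_not dP /definable_not dQ.
apply: definable_ext (definable_not (definable_and dP dQ)) => G _ v B /=.
by have := classic (P G v B); have := classic (Q G v B); tauto.
Qed.

Lemma definable_exv n l (P : vpred n.+1 l) :
  definable P -> definable (fun G v B => exists x, P G [tuple of x :: v] B).
Proof.
move=> [f fP]; have [h hP] := logic_exv f.
by exists h => G CG v B; rewrite hP; split=> -[x xP]; exists x; apply/fP.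
Qed.

Lemma definable_true n l : definable (fun G (_ : n.-tuple G) (_ : l.-tuple {set G}) => True).
Proof.
(* With n = 0 there may be no variable for an atom, and a sentence such as [exists x, x = x] fails
   on the empty graph. Hence this sentence [f] is used only inside the tautology [~ (f /\ ~ f)]. *)
have [e _] := logic_eq L l (@ord0 n) ord0; have [f _] := logic_exv e.
have df : definable (fun G v B => @sat _ L _ _ f G v B) by exists f.
apply: definable_ext (definable_not (definable_and df (definable_not df))).
by move=> G _ v B /=; tauto.
Qed.

Lemma definable_bool n l (b : bool) :
  definable (fun G (_ : n.-tuple G) (_ : l.-tuple {set G}) => b).
Proof.
case: b; first by apply: definable_ext (definable_true n l).
by apply: definable_ext (definable_not (definable_true n l)) => G _ v B; split=> // /(_ I).
Qed.

Lemma definable_forall_fin n l (I : finType) (P : I -> vpred n l) :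
  (forall i, definable (P i)) -> definable (fun G v B => forall i, P i G v B).
Proof.
move=> dP.
have dseq (s : seq I) : definable (fun G v B => forall i, i \in s -> P i G v B).
  elim: s => [|i s IHs]; first by apply: definable_ext (definable_true n l).
  apply: definable_ext (definable_and (dP i) IHs) => G _ v B.
  split=> [[Pi Ps] j|Ps]; first by rewrite inE => /predU1P [->|/Ps].
  by split=> [|j js]; apply: Ps; rewrite inE ?eqxx ?js ?orbT.
apply: definable_ext (dseq (enum I)) => G _ v B.
by split=> Ps i *; apply: Ps; rewrite ?mem_enum.
Qed.

(** A truth table in conjunctive form: for each of the finitely many assignments [a], either [f a]
    holds or the truth values of the [p i] differ from [a]. *)
Lemma definable_bool_comb n l (I : finType)
    (p : I -> forall G : cgraph Sigma, n.-tuple G -> l.-tuple {set G} -> bool)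
    (f : {ffun I -> bool} -> bool) :
  (forall i, definable (fun G v B => p i G v B)) ->
  definable (fun G v B => f [ffun i => p i G v B]).
Proof.
move=> dp.
have dpa (a : {ffun I -> bool}) i : definable (fun G v B => p i G v B = a i).
  case: (a i); first exact: dp.
  apply: definable_ext (definable_not (dp i)) => G _ v B.
  by split=> [/negP/negbTE|->].
have deq a := definable_forall_fin (dpa a).
apply: definable_ext (definable_forall_fin
  (fun a => definable_or (definable_bool n l (f a)) (definable_not (deq a)))).
move=> G _ v B; split=> [/(_ [ffun i => p i G v B]) [//|neq]|fp a].
  by case: neq => i; rewrite ffunE.
case: (classic (forall i, p i G v B = a i)) => pa; [left|by right].
by have <- : [ffun i => p i G v B] = a by apply/ffunP=> i; rewrite ffunE.
Qed.

Lemma definable_exvs t n l (P : vpred (t + n) l) : definable P ->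
  definable (fun G v B => exists d : t.-tuple G, P G [tuple of d ++ v] B).
Proof.
elim: t P => [|t IHt] P dP.
  apply: definable_ext dP => G _ v B.
  have cat0 (d : 0.-tuple G) : [tuple of d ++ v] = v.
    by apply: val_inj; rewrite /= [d]tuple0.
  by split=> [Pv|[d]]; [exists [tuple] | ]; rewrite cat0.
apply: definable_ext (IHt _ (definable_exv dP)) => G _ v B.
have consE x (d : t.-tuple G) :
  [tuple of x :: [tuple of d ++ v]] = [tuple of [tuple of x :: d] ++ v].
  exact: val_inj.
split=> [[d [x Pxd]]|[d]].
  by exists [tuple of x :: d]; rewrite -consE.
by rewrite [d]tuple_eta -consE => Pd; exists [tuple of behead d], (thead d).
Qed.

Lemma definable_eq n l x y : @is_var n x -> @is_var n y ->
  definable (fun G v (_ : l.-tuple {set G}) => x G v = y G v).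
Proof.
move=> [i xE] [j yE]; have [h hP] := logic_eq L l i j.
by exists h => G _ v B; rewrite hP xE yE.
Qed.

Lemma definable_adj n l x y : @is_var n x -> @is_var n y ->
  definable (fun G v (_ : l.-tuple {set G}) => adj (x G v) (y G v)).
Proof.
move=> [i xE] [j yE]; have [h hP] := logic_adj L l i j.
by exists h => G _ v B; rewrite hP xE yE.
Qed.

(* [logic_rename] only covers injective renamings, hence the detour through
   fresh variables [d] with [d = U v]. *)
Lemma definable_subst m n l (P : vpred m l)
    (U : forall G : cgraph Sigma, n.-tuple G -> m.-tuple G) :
  (forall i, is_var (fun G v => tnth (U G v) i)) -> definable P ->
  definable (fun G v B => P G (U G v) B).
Proof.
move=> varU [f fP].
have [g gP] := logic_rename (@lshift_inj m n) (fun _ _ => id) f.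
have dg : definable (fun G (w : (m + n).-tuple G) B =>
    P G [tuple tnth w (lshift n i) | i < m] B).
  exists g => G CG w B; rewrite gP fP //.
  suff -> : [tuple tnth B i | i < l] = B by [].
  by apply: eq_from_tnth => i; rewrite tnth_mktuple.
have dU : definable (fun G (w : (m + n).-tuple G) (_ : l.-tuple {set G}) =>
    forall i, tnth w (lshift n i) = tnth (U G (suffix_tuple w)) i).
  apply: definable_forall_fin => i; apply: definable_eq; first exact: is_var_tnth.
  exact: is_var_suffix (varU i).
apply: definable_ext (definable_exvs (definable_and dU dg)) => G _ v B.
have lE (d : m.-tuple G) : [tuple tnth [tuple of d ++ v] (lshift n i) | i < m] = d.
  by apply: eq_from_tnth => i; rewrite tnth_mktuple tnth_lshift.
split=> [[d []]|Pv]; last first.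
  by exists (U G v); rewrite lE suffix_tuple_cat; split=> // i; rewrite tnth_lshift.
rewrite lE suffix_tuple_cat => dU'; suff -> : d = U G v by [].
by apply: eq_from_tnth => i; rewrite -dU' tnth_lshift.
Qed.

Lemma definable_dummy_set n l (P : vpred n l) : definable P ->
  definable (fun G v (B : l.+1.-tuple {set G}) => P G v [tuple of behead B]).
Proof.
move=> [f fP].
have [h hP] := logic_rename (fun _ _ => id) (@lift_inj l.+1 ord0) f.
exists h => G CG v B; rewrite hP fP //.
have -> : [tuple tnth v i | i < n] = v.
  by apply: eq_from_tnth => i; rewrite tnth_mktuple.
suff -> : [tuple tnth B (lift ord0 i) | i < l] = [tuple of behead B] by [].
by apply: eq_from_tnth => i; rewrite tnth_mktuple [B in LHS]tuple_eta tnthS.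
Qed.

(** * Definable sets and the rank bound *)

(** Variable 0 is the candidate element and the others are parameters, as for [psi] in
    [low_rank_definability]. *)
Definition definable_set n l
    (S : forall G : cgraph Sigma, n.-tuple G -> l.-tuple {set G} -> {set G}) :=
  definable (fun G (v : n.+1.-tuple G) B => thead v \in S G [tuple of behead v] B).

Lemma definable_in n m l x U S : @is_var n x ->
  (forall i, is_var (fun G v => tnth (U G v) i)) -> @definable_set m l S ->
  definable (fun G v B => x G v \in S G (U G v) B).
Proof.
move=> varx varU dS.
apply: definable_ext (definable_subst (is_var_cons varx varU) dS) => G _ v B.
rewrite theadE; suff -> : [tuple of behead [tuple of x G v :: U G v]] = U G v by [].
exact: val_inj.
Qed.

(** Negate [rk_gtP]. The coefficient vectors [c] over the two-element field are finite in number, so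
    quantifying over them is a finite conjunction and only vertex quantifiers remain. *)
Lemma definable_rk n l S r : @definable_set n l S ->
  definable (fun G v B => rk (S G v B) <= r).
Proof.
move=> dS.
(* The sum depends on [z] only through its adjacencies [a] to the r + 1 chosen vertices, so it is a
   Boolean combination of atoms. *)
pose indep (c : 'rV['F_2]_r.+1) (a : {ffun 'I_r.+1 -> bool}) :=
  (\sum_i c ord0 i * (a i)%:R != 0)%R.
have dexz (c : 'rV['F_2]_r.+1) :
  definable (fun G (w : (r.+1 + n).-tuple G) (B : l.-tuple {set G}) =>
    exists z, z \notin S G (suffix_tuple w) B /\
      indep c [ffun i => adj (tnth w (lshift n i)) z]).
  have dnotin : definable (fun G (u : (r.+1 + n).+1.-tuple G) (B : l.-tuple {set G}) =>
      ~ (thead u \in S G (suffix_tuple [tuple of behead u]) B)).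
    apply/definable_not/definable_in => //; first exact: is_var_tnth.
    by move=> i; apply: is_var_behead (is_var_suffix r.+1 (is_var_tnth i)).
  have dindep := definable_bool_comb (indep c) (fun i =>
    @definable_adj (r.+1 + n).+1 l _ _ (is_var_tnth (lift ord0 (lshift n i))) (is_var_tnth ord0)).
  apply: definable_ext (definable_exv (definable_and dnotin dindep)) => G _ w B.
  have behE z : [tuple of behead [tuple of z :: w]] = w by apply: val_inj.
  have adjE z : [ffun i => adj (tnth [tuple of z :: w] (lift ord0 (lshift n i)))
      (tnth [tuple of z :: w] ord0)] = [ffun i => adj (tnth w (lshift n i)) z].
    by apply/ffunP=> i; rewrite !ffunE tnthS tnth0.
  by split=> -[z]; [rewrite behE | ]; rewrite ?adjE ?theadE => -[/negP ? ?]; exists z;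
    rewrite ?behE ?adjE ?theadE.
have dy : definable (fun G (w : (r.+1 + n).-tuple G) (B : l.-tuple {set G}) =>
    forall i, tnth w (lshift n i) \in S G (suffix_tuple w) B).
  apply: definable_forall_fin => i; apply: definable_in => //; first exact: is_var_tnth.
  by move=> j; apply: is_var_suffix (is_var_tnth j).
have dz := definable_forall_fin (fun c : 'rV['F_2]_r.+1 =>
  definable_or (definable_bool _ _ (c == 0%R)) (dexz c)).
apply: definable_ext (definable_not (definable_exvs (definable_and dy dz))) => G _ v B.
rewrite leqNgt; apply: iff_trans (rwP negP); apply: not_iff_compat.
apply: iff_trans (iff_sym (rk_gtP _ _)).
have indepE c (y : r.+1.-tuple G) z :
    indep c [ffun i => adj (tnth [tuple of y ++ v] (lshift n i)) z] =
    (\sum_i c ord0 i * (adj (tnth y i) z)%:R != 0)%R.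
  by rewrite /indep; under eq_bigr => i _ do rewrite ffunE tnth_lshift.
split=> -[y [yS yindep]]; exists y; split=> [i|c].
- by have := yS i; rewrite suffix_tuple_cat tnth_lshift.
- move/negP=> c0; have [//|[z]] := yindep c.
  by rewrite suffix_tuple_cat indepE; exists z.
- by rewrite suffix_tuple_cat tnth_lshift.
have [->|/yindep [z zP]] := eqVneq c 0%R; first by left.
by right; exists z; rewrite suffix_tuple_cat indepE.
Qed.

(** * Substitution of definable sets into low rank MSO formulas *)

(* Since [L] need not be closed under substituting formulas for set variables,
   the substitution of definable sets [F G v B] is part of the property. *)
Definition substitutable m k (P : vpred m k) :=
  forall n l (U : forall G : cgraph Sigma, n.-tuple G -> m.-tuple G)
    (F : forall G : cgraph Sigma, n.-tuple G -> l.-tuple {set G} -> k.-tuple {set G}),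
  (forall i, is_var (fun G v => tnth (U G v) i)) ->
  (forall i, definable_set (fun G v B => tnth (F G v B) i)) ->
  definable (fun G v B => P G (U G v) (F G v B)).

Lemma substitutable_ext m k (P Q : vpred m k) :
  (forall G v B, P G v B <-> Q G v B) -> substitutable P -> substitutable Q.
Proof.
move=> PQ sP n l U F varU dF; apply: definable_ext (sP n l U F varU dF).
by move=> G _ v B; apply: PQ.
Qed.

Lemma substitutable_not m k (P : vpred m k) :
  substitutable P -> substitutable (fun G v B => ~ P G v B).
Proof. by move=> sP n l U F varU dF; apply/definable_not/sP. Qed.

Lemma substitutable_exv m k (P : vpred m.+1 k) : substitutable P ->
  substitutable (fun G v B => exists x, P G [tuple of x :: v] B).
Proof.
move=> sP n l U F varU dF.
have dP : definable (fun G (w : n.+1.-tuple G) B =>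
    P G [tuple of thead w :: U G [tuple of behead w]] (F G [tuple of behead w] B)).
  apply: (sP _ _ (fun G w => [tuple of thead w :: U G [tuple of behead w]])
                 (fun G w B => F G [tuple of behead w] B)) => i.
    apply: is_var_cons; first exact: is_var_tnth.
    by move=> j; apply: is_var_behead (varU j).
  (* Two variables precede the parameters of [F]: the element tested for membership and the bound
     vertex; hence the two uses of [is_var_behead]. *)
  apply: definable_in (dF i); first exact: is_var_tnth.
  by move=> j; apply: is_var_behead (is_var_behead (is_var_tnth j)).
apply: definable_ext (definable_exv dP) => G _ v B.
have behE x : [tuple of behead [tuple of x :: v]] = v by apply: val_inj.
by split=> -[x Px]; exists x; move: Px; rewrite behE theadE.
Qed.

Definition set_of_pred (G : cgraph Sigma) (P : G -> Prop) : {set G} :=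
  [set x | if excluded_middle_informative (P x) then true else false].

Lemma in_set_of_pred (G : cgraph Sigma) (P : G -> Prop) x :
  x \in set_of_pred P <-> P x.
Proof. by rewrite inE; case: excluded_middle_informative. Qed.

Hypothesis hL : low_rank_definability L C.

(* Substitutability is used twice: with a fresh set variable for [X], which
   yields a formula to which low rank definability applies, and with the
   definition of [X] so obtained. *)
Lemma substitutable_exs m k r (P : vpred m k.+1) : substitutable P ->
  substitutable (fun G v B => exists X, rk X <= r /\ P G v [tuple of X :: B]).
Proof.
move=> sP n l U F varU dF.
have dX : definable_set (fun G (_ : n.-tuple G) (B : l.+1.-tuple {set G}) => thead B).
  by have [h hP] := logic_mem L (@ord0 n) (@ord0 l); exists h => G _ v B; rewrite hP.
have dP : definable (fun G v (B : l.+1.-tuple {set G}) =>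
    P G (U G v) [tuple of thead B :: F G v [tuple of behead B]]).
  apply: (sP _ _ U (fun G v B => [tuple of thead B :: F G v [tuple of behead B]])) => // i.
  case: (unliftP ord0 i) => [j|] ->; last exact: dX.
  apply: definable_ext (definable_dummy_set (dF j)) => G _ v B.
  by rewrite tnthS.
have [phi phiP] := definable_and (definable_rk r dX) dP.
have [t [psi psiP]] := hL r phi.
pose S (G : cgraph Sigma) (w : (t + n).-tuple G) B :=
  set_of_pred (fun x : G => sat psi [tuple of x :: w] B).
have dS : definable_set S.
  by exists psi => G _ v B; rewrite in_set_of_pred -tuple_eta.
have dPS : definable (fun G w B =>
    P G (U G (suffix_tuple w)) [tuple of S G w B :: F G (suffix_tuple w) B]).
  apply: (sP _ _ (fun G w => U G (suffix_tuple w))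
    (fun G w B => [tuple of S G w B :: F G (suffix_tuple w) B])) => i.
    exact: is_var_suffix (varU i).
  case: (unliftP ord0 i) => [j|] ->; last exact: dS.
  have dFj : definable (fun G (w : (t + n).+1.-tuple G) B =>
      thead w \in tnth (F G (suffix_tuple [tuple of behead w]) B) j).
    apply: definable_in (dF j); first exact: is_var_tnth.
    by move=> a; apply: is_var_behead (is_var_suffix t (is_var_tnth a)).
  by apply: definable_ext dFj => G _ v B; rewrite tnthS.
(* The rank bound and [P] are checked again for the set defined by [d], so a tuple that defines an
   unrelated set does no harm. *)
apply: definable_ext (definable_exvs (definable_and (definable_rk r dS) dPS)).
move=> G CG v B; have behE X : [tuple of behead [tuple of X :: B]] = B by apply: val_inj.
split=> [[d]|[X [rkX PX]]].
  by rewrite suffix_tuple_cat; exists (S G [tuple of d ++ v] B).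
have [|A [d [satA AE]]] := psiP G CG B v.
  by exists X; split=> //; apply/phiP => //; rewrite theadE behE.
exists d; have -> : S G [tuple of d ++ v] B = A.
  by apply/setP=> x; apply/idP/idP; rewrite AE in_set_of_pred.
by move/(phiP G CG): satA; rewrite theadE behE suffix_tuple_cat.
Qed.

Lemma lrsat_substitutable m k (f : lrmso Sigma m k) :
  substitutable (fun G v B => lrsat f v B).
Proof.
elim: f => {m k} [m k x y|m k x y|m k c x|m k x X|m k f IHf|m k f IHf g IHg
  |m k f IHf g IHg|m k f IHf|m k f IHf|m k r f IHf|m k r f IHf] /=.
- by move=> n l U F varU _; apply: (definable_adj l (varU x) (varU y)).
- by move=> n l U F varU _; apply: (definable_eq l (varU x) (varU y)).
- move=> n l U F varU _; have [j jP] := varU x.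
  by have [h hP] := logic_color L l c j; exists h => G _ v B; rewrite hP jP.
(* The one atom that needs [dF]: membership in [X] becomes the formula defining the set substituted
   for [X]. *)
- move=> n l U F varU dF.
  by apply: (definable_in (U := fun G v => v) (varU x) _ (dF X)) => i; apply: is_var_tnth.
- exact: substitutable_not.
- by move=> n l U F varU dF; apply: definable_and; [apply: IHf | apply: IHg].
- by move=> n l U F varU dF; apply: definable_or; [apply: IHf | apply: IHg].
- exact: substitutable_exv.
- apply: substitutable_ext (substitutable_not (substitutable_exv (substitutable_not IHf))).
  move=> G v B; split=> [nex x|all [x]]; last exact.
  by apply: NNPP => nf; apply: nex; exists x.
- exact: substitutable_exs.
apply: substitutable_ext (substitutable_not (substitutable_exs r (substitutable_not IHf))).
move=> G v B; split=> [nex X rkX|all [X [rkX]]]; last by apply; apply: all.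
by apply: NNPP => nf; apply: nex; exists X.
Qed.

End Definability.

Theorem theorem3p2 (Sigma : Type) (L : logic Sigma) (C : cgraph Sigma -> Prop)
    (hFO : extends_FO L) (hL : low_rank_definability L C)
    (m k : nat) (phi : lrmso Sigma m k) :
  exists psi : form L m k,
    forall G : cgraph Sigma, C G ->
    forall (v : m.-tuple G) (B : k.-tuple {set G}),
      lrsat phi v B <-> sat psi v B.
Proof.
(* The identity substitution is admissible because each set variable is defined by its own
   membership atom. *)
apply: (lrsat_substitutable hL phi (U := fun G v => v) (F := fun G v B => B)) => i.
  exact: is_var_tnth.
have [h hP] := logic_mem L (@ord0 m) i.
by exists h => G _ v B; rewrite hP.
Qed.
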